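(* Let $d>0$. For any $\varepsilon>0$ there exist a separable Hilbert space $\mathfrak{H}$, a bounded self-adjoint operator $A$ on $\mathfrak{H}$ whose spectrum satisfies $\mathrm{spec}(A)=\sigma\cup\Sigma$ with $\mathrm{dist}(\sigma,\Sigma)=d$, and a bounded self-adjoint operator $V$ on $\mathfrak{H}$ with $\|V\|=\frac d2+\varepsilon$ such that $$\|\mathsf{E}_A(\sigma)-Q\|=1$$ for the orthogonal projection $Q$ onto an arbitrary (closed) invariant subspace of the operator $A+V$. In particular, $\|\mathsf{E}_A(\sigma)-\mathsf{E}_{A+V}(\Delta)\|=1$ for any Borel set $\Delta\subset\mathbb{R}$.
   Context: $\mathrm{spec}(A)$ denotes the spectrum of $A$. For a Borel set $\Delta\subset\mathbb{R}$ and a bounded self-adjoint operator $B$, $\mathsf{E}_B(\Delta)$ denotes the spectral projection of $B$ corresponding to $\Delta$. For nonempty $S,T\subset\mathbb{R}$, $\mathrm{dist}(S,T)=\inf\{|s-t| : s\in S, t\in T\}$. $\|\cdot\|$ is the operator norm. *)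

(* Defs.v *)
From HB Require Import structures.
From mathcomp Require Import all_boot all_order all_algebra complex.
From mathcomp Require Import all_classical all_reals all_analysis.

Set Implicit Arguments.
Unset Strict Implicit.
Unset Printing Implicit Defensive.

Import Order.TTheory GRing.Theory Num.Theory.
Import numFieldNormedType.Exports.

Local Open Scope classical_set_scope.
Local Open Scope ring_scope.
Local Open Scope complex_scope.

(* Complex Hilbert spaces: complete normed spaces over R[i] whose norm comes
   from an inner product, linear in its first argument.  Norms of vectors are
   (nonnegative real) elements of R[i]. *)
HB.mixin Record CompleteNormedModule_isHilbert (R : realType) H
    of CompleteNormedModule R[i] H := {
  inner : H -> H -> R[i] ;
  innerDl : forall x y z : H, inner (x + y) z = inner x z + inner y z ;
  innerZl : forall (a : R[i]) (x y : H), inner (a *: x) y = a * inner x y ;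
  innerC : forall x y : H, inner y x = (inner x y)^* ;
  inner_norm : forall x : H, inner x x = `|x| ^+ 2
}.

#[short(type="hilbertType")]
HB.structure Definition Hilbert (R : realType) :=
  {H of CompleteNormedModule_isHilbert R H & CompleteNormedModule R[i] H}.

Definition separable_space (T : topologicalType) : Prop :=
  exists D : set T, countable D /\ dense D.

Section Operators.
Context {R : realType} {H : hilbertType R}.

Definition bounded_op (T : H -> H) : Prop :=
  exists M : R, forall x : H, `|T x| <= M%:C * `|x|.

Definition opnorm (T : H -> H) : R :=
  sup [set complex.Re `|T x| | x in [set x : H | `|x| <= 1]].

Definition selfadjoint (T : H -> H) : Prop :=
  forall x y : H, inner (T x) y = inner x (T y).

Definition spectrum (T : H -> H) : set R[i] :=
  [set z | ~ exists S : {linear H -> H},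
     [/\ bounded_op S,
         forall x, S (z *: x - T x) = x
       & forall x, z *: S x - T (S x) = x]].

Definition closed_subspace (M : set H) : Prop :=
  [/\ closed M, M 0
    & forall (a : R[i]) (x y : H), M x -> M y -> M (a *: x + y)].

Definition invariant_subspace (T : H -> H) (M : set H) : Prop :=
  forall x : H, M x -> M (T x).

Definition orthoproj_onto (M : set H) (P : H -> H) : Prop :=
  forall x : H, M (P x) /\ forall y : H, M y -> inner (x - P x) y = 0.

Definition orthoproj (P : H -> H) : Prop :=
  exists M : set H, closed_subspace M /\ orthoproj_onto M P.

(* E is a projection-valued Borel measure on R and B is the integral of the
   identity with respect to E.  The latter is expressed by quadratic forms:
   <B x, x> is the integral of the identity for the measure
   Delta |-> <E(Delta) x, x>; by polarization this determines B. *)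
Record spectral_measure_of (B : H -> H) (E : set R -> H -> H) : Prop := {
  spectral_proj : forall Delta : set R, measurable Delta ->
    orthoproj (E Delta) ;
  spectral_setT : forall x : H, E setT x = x ;
  spectral_sigma_additive : forall F : (set R)^nat,
    (forall n, measurable (F n)) -> trivIset setT F ->
    forall x : H,
      (\sum_(0 <= k < n) E (F k) x) @[n --> \oo] --> E (\bigcup_n F n) x ;
  spectral_integral : forall x : H,
    exists mu : {measure set (measurableTypeR R) -> \bar R},
      [/\ forall Delta : set R, measurable Delta ->
            mu Delta = (complex.Re (inner (E Delta x) x))%:E,
          mu.-integrable setT (EFin : measurableTypeR R -> \bar R)
        & inner (B x) x = (\int[mu]_t (t : R))%R%:C]
}.

(* For bounded self-adjoint B the spectral theorem says that exactly one E (up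
   to its values on non-Borel sets) satisfies [spectral_measure_of B E], so the
   default value plays no role. *)
Definition spectral_projection (B : H -> H) : set R -> H -> H :=
  xget (fun _ _ => 0) [set E | spectral_measure_of B E].

End Operators.

Definition setdist {R : realType} (S T : set R) : R :=
  inf [set `|s - t| | s in S & t in T].

(* Main.v *)
From HB Require Import structures.
Require Import Defs.
From mathcomp Require Import all_boot all_order all_algebra complex.
From mathcomp Require Import all_classical all_reals all_analysis.
From mathcomp Require Import measurable_realfun ring lra.

(** The operator A has two spectral values d/2 and -d/2, and its eigenspace for
    d/2 is a line, spanned by a unit vector u; thus A is d/2 times (2 P - 1) with
    P the projection onto u, and E_A(d/2) = P.  The perturbed operator B = A + V
    is small, of norm at most eps, and has no eigenvectors.  An invariant
    subspace M of B is then either zero or of dimension at least two.  If M is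
    zero, then P - Q = P has norm 1.  Otherwise M contains a nonzero vector
    orthogonal to u; there P vanishes and Q is the identity, so P - Q has norm at
    least 1, and a difference of two orthogonal projections has norm at most 1.
    This is [opnorm_line_proj_invariant].

    For B one takes eps/2 times the sum of the two shifts on the space of
    square-summable sequences over nat, with u the first basis vector.  The
    three-term recursion for an eigenvector has a conserved quadratic quantity,
    which rules out nonzero square-summable solutions
    ([jacobi_no_eigenvector]).  The bound d/2 + eps for V = B - A is the triangle
    inequality; it is the exact norm because B has approximate eigenvectors at
    eps orthogonal to u, where A acts as -d/2 ([opnorm_perturbation]).

    The spectral projections are values of an arbitrary spectral measure.  Two
    facts about such a measure suffice.  The ranges of its projections are
    invariant ([spectral_invariant]), so that the claim about Borel sets is a
    case of the claim about invariant subspaces.  It fixes an eigenvector at the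
    corresponding point ([spectral_eigen]), so that the spectral projection of A
    at d/2 is P, once the two-point measure of A is seen to exist
    ([two_point_spectral_measure]). *)

Set Implicit Arguments.
Unset Strict Implicit.
Unset Printing Implicit Defensive.

Import Order.TTheory GRing.Theory Num.Theory.
Import numFieldNormedType.Exports.

Local Open Scope classical_set_scope.
Local Open Scope ring_scope.
Local Open Scope complex_scope.

(** * Limits of complex numbers *)

(** The norm topology that any numeric field carries, attached to the type
    of complex numbers itself so that limits can be written there directly. *)
HB.instance Definition _ (R : realType) := NormedModule.copy R[i] R[i]^o.

Section ComplexTopology.
Context {R : realType}.
Implicit Types z w : R[i].

(** The squared modulus, as a real number. *)
Definition sqn z : R := complex.Re z ^+ 2 + complex.Im z ^+ 2.

Lemma sqnE z : `|z| ^+ 2 = (sqn z)%:C.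
Proof. by rewrite /sqn add_Re2_Im2. Qed.

Lemma sqn_ge0 z : 0 <= sqn z.
Proof. by rewrite addr_ge0// sqr_ge0. Qed.

Lemma sqn_eq0 z : sqn z = 0 -> z = 0.
Proof.
move=> z0; apply/normr0_eq0/eqP.
by rewrite -sqrf_eq0 sqnE z0.
Qed.

Lemma sqnD_le z w : sqn (z + w) <= 2 * (sqn z + sqn w).
Proof.
case: z w => [a b] [c d]; rewrite /sqn /=.
have := sqr_ge0 (a - c); have := sqr_ge0 (b - d); nra.
Qed.

Lemma sqnM z w : sqn (z * w) = sqn z * sqn w.
Proof. by case: z w => [a b] [c d]; rewrite /sqn /=; ring. Qed.

Lemma norm_Re_le z : `|complex.Re z| <= complex.Re `|z|.
Proof. by have := normc_ge_Re z; rewrite lecE => /andP[_]. Qed.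

Lemma norm_Im_le z : `|complex.Im z| <= complex.Re `|z|.
Proof.
rewrite normc_def /= -(sqrtr_sqr (complex.Im z)) ler_sqrt ?lerDr ?sqr_ge0//.
by rewrite addr_ge0// sqr_ge0.
Qed.

Lemma norm_le_ReIm z : `|z| <= (`|complex.Re z| + `|complex.Im z|)%:C.
Proof.
case: z => a b; rewrite normc_def lecR /=.
rewrite -(@ler_pXn2r _ 2)// ?nnegrE ?sqrtr_ge0 ?addr_ge0//.
rewrite sqr_sqrtr ?addr_ge0 ?sqr_ge0//.
rewrite sqrrD !real_normK ?num_real//.
by rewrite addrAC lerDl mulrn_wge0// mulr_ge0.
Qed.

Lemma gt0_complexE (e : R[i]) : 0 < e -> exists2 r : R, 0 < r & e = r%:C.
Proof.
case: e => a b; rewrite ltcE /= => /andP[/eqP -> a0].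
by exists a.
Qed.

Section Filters.
Context {T : Type} {F : set_system T} {FF : Filter F}.
Implicit Types f : T -> R[i].

Lemma cvg_Re f z : f x @[x --> F] --> z ->
  complex.Re (f x) @[x --> F] --> complex.Re z.
Proof.
move=> /cvgrPdist_lt fz; apply/cvgrPdist_lt => e e0.
have e0' : 0 < e%:C :> R[i] by rewrite ltcR.
have := fz _ e0'; apply: filterS => x.
rewrite -raddfB /= => H; apply: le_lt_trans (norm_Re_le _) _.
by move: H; rewrite ltcE => /andP[].
Qed.

Lemma cvg_Im f z : f x @[x --> F] --> z ->
  complex.Im (f x) @[x --> F] --> complex.Im z.
Proof.
move=> /cvgrPdist_lt fz; apply/cvgrPdist_lt => e e0.
have e0' : 0 < e%:C :> R[i] by rewrite ltcR.
have := fz _ e0'; apply: filterS => x.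
rewrite -raddfB /= => H; apply: le_lt_trans (norm_Im_le _) _.
by move: H; rewrite ltcE => /andP[].
Qed.

Lemma cvg_complex f z :
  complex.Re (f x) @[x --> F] --> complex.Re z ->
  complex.Im (f x) @[x --> F] --> complex.Im z -> f x @[x --> F] --> z.
Proof.
move=> /cvgrPdist_lt fR /cvgrPdist_lt fI; apply/cvgrPdist_lt => _ /gt0_complexE[e e0 ->].
have e2 : 0 < e / 2 by rewrite divr_gt0.
move: (fR _ e2) (fI _ e2); apply: filterS2 => x Hr Hi.
apply: le_lt_trans (norm_le_ReIm _) _; rewrite ltcR !raddfB /=.
by rewrite [e]splitr ltrD.
Qed.

Lemma cvg_conjc f z : f x @[x --> F] --> z -> (f x)^* @[x --> F] --> z^*.
Proof.
move=> fz.
have RJ w : complex.Re w^* = complex.Re w by case: w.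
have IJ w : complex.Im w^* = - complex.Im w by case: w.
apply: cvg_complex; first by under eq_fun do rewrite RJ; rewrite RJ; exact: cvg_Re.
by under eq_fun do rewrite IJ; rewrite IJ; apply: cvgN; exact: cvg_Im.
Qed.

End Filters.

Lemma complex_complete (F : set_system R[i]) :
  ProperFilter F -> cauchy F -> cvg F.
Proof.
move=> FF /cauchyP Fc.
have pull (p : R[i] -> R) : (forall z w, `|p z - p w| <= complex.Re `|z - w|) ->
    cvg (p x @[x --> F]).
  move=> pL; apply: R_complete; apply/cauchyP => e e0.
  have e0' : 0 < e%:C :> R[i] by rewrite ltcR.
  have [z Fz] := Fc _ e0'.
  exists (p z); suff : F (p @^-1` ball (p z) e) by [].
  apply: filterS Fz => w.
  rewrite /ball /= => zw; apply: le_lt_trans (pL _ _) _.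
  by move: zw; rewrite ltcE => /andP[].
have [a Fa] : exists a : R, complex.Re x @[x --> F] --> a.
  by apply/cvg_ex; apply: pull => z w; rewrite -raddfB norm_Re_le.
have [b Fb] : exists b : R, complex.Im x @[x --> F] --> b.
  by apply/cvg_ex; apply: pull => z w; rewrite -raddfB norm_Im_le.
apply/cvg_ex; exists (a +i* b).
exact: (@cvg_complex _ F _ id).
Qed.

End ComplexTopology.

(** * The space of square-summable complex sequences *)

(** The triangle inequality has to precede any norm, because the norm is to be
    built from the form.  It follows from the Cauchy-Schwarz inequality for the
    real part of the form. *)
Lemma sqrt_form_triangle (R : realType) (V : lmodType R[i]) (f : V -> V -> R[i]) :
  (forall x y z, f (x + y) z = f x z + f y z) ->
  (forall a x y, f (a *: x) y = a * f x y) ->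
  (forall x y, f y x = (f x y)^*) ->
  (forall x, 0 <= f x x) -> (forall x, f x x = 0 -> x = 0) ->
  forall x y, Num.sqrt (complex.Re (f (x + y) (x + y))) <=
    Num.sqrt (complex.Re (f x x)) + Num.sqrt (complex.Re (f y y)).
Proof.
move=> fD fZ fC f_ge0 f_eq0 x y.
have p_ge0 z : 0 <= complex.Re (f z z) by have := f_ge0 z; rewrite lecE => /andP[].
have fDr u v w : f u (v + w) = f u v + f u w.
  by rewrite (fC (v + w)) fD rmorphD /= -!fC.
have pD u v : complex.Re (f (u + v) (u + v)) =
    complex.Re (f u u) + 2 * complex.Re (f u v) + complex.Re (f v v).
  rewrite fD !fDr (fC u v); case: (f u u) (f u v) (f v v) => [? ?] [? ?] [? ?] /=.
  by ring.
have fZr (t : R) u v : f u (t%:C *: v) = t%:C * f u v.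
  by rewrite (fC (t%:C *: v)) fZ rmorphM /= -fC oppr0.
have CS : complex.Re (f x y) <= Num.sqrt (complex.Re (f x x)) * Num.sqrt (complex.Re (f y y)).
  have [y0|y0] := eqVneq (complex.Re (f y y)) 0.
    have -> : y = 0.
      by apply/f_eq0; have := f_ge0 y; move: y0; case: (f y y) => a b /= ->;
        rewrite lecE /= => /andP[/eqP ->].
    by rewrite -(scale0r 0) (fZr 0) mul0r mulr_ge0 ?sqrtr_ge0.
  have py : 0 < complex.Re (f y y) by rewrite lt_def y0 p_ge0.
  apply: le_trans (ler_norm _) _; rewrite -sqrtrM// -sqrtr_sqr ler_sqrt ?mulr_ge0//.
  (* the minimum over t of the form at x + t y is nonnegative *)
  set t : R := - (complex.Re (f x y) / complex.Re (f y y)).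
  have := p_ge0 (x + t%:C *: y); rewrite pD fZ !fZr.
  move: (f x x) (f x y) (f y y) py @t => [a ?] [b ?] [c ?] /= c0.
  rewrite !mul0r !subr0 => min_ge0; rewrite -subr_ge0.
  rewrite (_ : _ - _ = c * (a + 2 * (- (b / c) * b) + - (b / c) * (- (b / c) * c))).
    by rewrite mulr_ge0// ltW.
  by field; rewrite gt_eqF.
rewrite -(@ler_pXn2r _ 2)// ?nnegrE ?addr_ge0 ?sqrtr_ge0// sqrrD !sqr_sqrtr// pD.
by rewrite lerD2r lerD2l -[leRHS]mulr_natl ler_wpM2l.
Qed.

Definition sqsum {R : realType} : {pred nat -> R[i]} :=
  fun f => `[< exists M, forall n, \sum_(0 <= k < n) sqn (f k) <= M >].

Lemma sqsum_submod (R : realType) : submod_closed (@sqsum R).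
Proof.
split.
  apply/asboolP; exists 0 => n; rewrite big1// => k _.
  by rewrite /sqn /= expr0n addr0.
move=> a f g /asboolP[M fM] /asboolP[N gN]; apply/asboolP.
exists (2 * (sqn a * M + N)) => n.
apply: le_trans (_ : \sum_(0 <= k < n) 2 * (sqn a * sqn (f k) + sqn (g k)) <= _).
  by apply: ler_sum => k _; rewrite -sqnM; exact: sqnD_le.
by rewrite -mulr_sumr big_split -mulr_sumr ler_wpM2l// lerD ?ler_wpM2l ?sqn_ge0.
Qed.

HB.instance Definition _ (R : realType) :=
  GRing.isSubmodClosed.Build _ _ (@sqsum R) (@sqsum_submod R).

Record l2 (R : realType) := L2 { l2val :> nat -> R[i] ; l2P : l2val \in sqsum }.

HB.instance Definition _ (R : realType) := [isSub of l2 R for @l2val R].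
HB.instance Definition _ (R : realType) := [Choice of l2 R by <:].
HB.instance Definition _ (R : realType) := [SubChoice_isSubLmodule of l2 R by <:].

Section SquareSummable.
Context {R : realType}.
Implicit Types (x y z : l2 R) (a : R[i]).

Lemma l2_ext x y : (forall k, x k = y k) -> x = y.
Proof. by move=> xy; apply/val_inj/funext. Qed.

Lemma l2D x y k : (x + y) k = x k + y k. Proof. by []. Qed.
Lemma l2Z a x k : (a *: x) k = a * x k. Proof. by []. Qed.
Lemma l2N x k : (- x) k = - x k. Proof. by []. Qed.
Lemma l20 k : (0 : l2 R) k = 0. Proof. by []. Qed.

Lemma cvg_sqn x : cvgn (series (fun k => sqn (x k))).
Proof.
have /asboolP[M xM] := l2P x.
apply: nondecreasing_is_cvgn; last by exists M => _ [n _ <-]; exact: xM.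
by apply/nondecreasing_seqP => n; rewrite seriesSr lerDl sqn_ge0.
Qed.

(** Comparison with the convergent series of squared moduli. *)
Lemma cvg_l2_bounded (u : nat -> R) x y :
  (forall k, `|u k| <= sqn (x k) + sqn (y k)) -> cvgn (series u).
Proof.
move=> u_le; apply: normed_cvg.
apply: series_le_cvg u_le _ => // [k|]; first by rewrite addr_ge0 ?sqn_ge0.
rewrite (_ : (fun k => _) = (fun k => sqn (x k)) + (fun k => sqn (y k)))//.
by rewrite seriesD; apply: is_cvgD; exact: cvg_sqn.
Qed.

Definition inner_l2 x y : R[i] := limn (series (fun k => x k * (y k)^*%C)).

Lemma Re_sum (I : Type) (r : seq I) (u : I -> R[i]) :
  complex.Re (\sum_(k <- r) u k) = \sum_(k <- r) complex.Re (u k).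
Proof. exact: raddf_sum. Qed.

Lemma Im_sum (I : Type) (r : seq I) (u : I -> R[i]) :
  complex.Im (\sum_(k <- r) u k) = \sum_(k <- r) complex.Im (u k).
Proof. exact: raddf_sum. Qed.

Lemma cvg_inner_l2 x y :
  series (fun k => x k * (y k)^*%C) @ \oo --> inner_l2 x y.
Proof.
suff [z xyz] : exists z : R[i], series (fun k => x k * (y k)^*%C) @ \oo --> z.
  by rewrite /inner_l2 (cvg_lim _ xyz).
have /cvg_ex[a cvga] : cvgn (series (fun k => complex.Re (x k * (y k)^*%C))).
  apply: (@cvg_l2_bounded _ x y) => k.
  case: (x k) (y k) => [a b] [c d]; rewrite /sqn /= ler_norml.
  by have := sqr_ge0 (a - c); have := sqr_ge0 (b - d);
    have := sqr_ge0 (a + c); have := sqr_ge0 (b + d); move=> *; apply/andP; split; nra.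
have /cvg_ex[b cvgb] : cvgn (series (fun k => complex.Im (x k * (y k)^*%C))).
  apply: (@cvg_l2_bounded _ x y) => k.
  case: (x k) (y k) => [a' b] [c d]; rewrite /sqn /= ler_norml.
  by have := sqr_ge0 (b - c); have := sqr_ge0 (a' - d);
    have := sqr_ge0 (b + c); have := sqr_ge0 (a' + d); move=> *; apply/andP; split; nra.
exists (a +i* b); apply: cvg_complex.
  by under eq_fun do rewrite Re_sum.
by under eq_fun do rewrite Im_sum.
Qed.

Lemma inner_l2P x y (z : R[i]) :
  series (fun k => x k * (y k)^*%C) @ \oo --> z -> inner_l2 x y = z.
Proof. by move=> xyz; exact: cvg_lim. Qed.

Lemma inner_l2Dl x y z : inner_l2 (x + y) z = inner_l2 x z + inner_l2 y z.
Proof.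
apply: inner_l2P.
rewrite (_ : (fun k => _) = (fun k => x k * (z k)^*%C) + (fun k => y k * (z k)^*%C)).
  by rewrite seriesD; apply: cvgD; exact: cvg_inner_l2.
by apply/funext => k; rewrite l2D mulrDl.
Qed.

Lemma inner_l2Zl a x y : inner_l2 (a *: x) y = a * inner_l2 x y.
Proof.
apply: inner_l2P.
rewrite (_ : series _ = (fun n => a * series (fun k => x k * (y k)^*%C) n)).
  by apply: cvgMl_tmp; exact: cvg_inner_l2.
by apply/funext => n; rewrite /series /= mulr_sumr; apply: eq_bigr => k _; rewrite mulrA.
Qed.

Lemma inner_l2C x y : inner_l2 y x = (inner_l2 x y)^*.
Proof.
apply: inner_l2P.
rewrite (_ : series _ = (fun n => (series (fun k => x k * (y k)^*%C) n)^*)).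
  by apply: cvg_conjc; exact: cvg_inner_l2.
apply/funext => n; rewrite /series /= rmorph_sum; apply: eq_bigr => k _.
by rewrite rmorphM /= conjcK mulrC.
Qed.

Lemma inner_l2_sqn x : inner_l2 x x = (limn (series (fun k => sqn (x k))))%:C.
Proof.
apply: inner_l2P; apply: cvg_complex.
  rewrite (_ : (fun n => _) = series (fun k => sqn (x k))) /=; first exact: (@cvg_sqn x).
  apply/funext => n; rewrite Re_sum; apply: eq_bigr => k _.
  by case: (x k) => a b; rewrite /sqn /=; ring.
rewrite (_ : (fun n => _) = fun=> 0) /=; first exact: cvg_cst.
apply/funext => n; rewrite Im_sum; apply: big1 => k _.
by case: (x k) => a b /=; ring.
Qed.

Lemma series_sqn_le x n : \sum_(0 <= k < n) sqn (x k) <= complex.Re (inner_l2 x x).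
Proof.
rewrite inner_l2_sqn /=; apply: (nondecreasing_cvgn_le _ (@cvg_sqn x) n).
by apply/nondecreasing_seqP => m; rewrite seriesSr lerDl sqn_ge0.
Qed.

Lemma inner_l2_le x (M : R) :
  (forall n, \sum_(0 <= k < n) sqn (x k) <= M) -> complex.Re (inner_l2 x x) <= M.
Proof.
move=> xM; rewrite inner_l2_sqn /=; apply: limr_le; first exact: (@cvg_sqn x).
by apply: nearW => n; exact: xM.
Qed.

Lemma inner_l2_ge0 x : 0 <= inner_l2 x x.
Proof.
rewrite inner_l2_sqn ler0c; apply: limr_ge; first exact: (@cvg_sqn x).
by apply: nearW => n; apply: sumr_ge0 => k _; exact: sqn_ge0.
Qed.

Lemma inner_l2_eq0 x : inner_l2 x x = 0 -> x = 0.
Proof.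
move=> x0; apply: l2_ext => k; apply: sqn_eq0; apply/eqP.
rewrite eq_le sqn_ge0 andbT.
have := series_sqn_le x k.+1; rewrite x0 big_nat_recr//=.
by apply: le_trans; rewrite lerDr sumr_ge0// => j _; exact: sqn_ge0.
Qed.

Definition norm_l2 x : R[i] := (Num.sqrt (complex.Re (inner_l2 x x)))%:C.

Lemma norm_l2_ge0 x : 0 <= norm_l2 x.
Proof. by rewrite ler0c sqrtr_ge0. Qed.

Lemma norm_l2D x y : norm_l2 (x + y) <= norm_l2 x + norm_l2 y.
Proof.
rewrite -rmorphD lecR; apply: sqrt_form_triangle.
- exact: inner_l2Dl.
- exact: inner_l2Zl.
- exact: inner_l2C.
- exact: inner_l2_ge0.
- exact: inner_l2_eq0.
Qed.

Lemma norm_l2_sqr x : inner_l2 x x = norm_l2 x ^+ 2.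
Proof.
rewrite -rmorphXn /= sqr_sqrtr.
  by rewrite inner_l2_sqn.
by have := inner_l2_ge0 x; rewrite lecE => /andP[].
Qed.

Lemma norm_l2Z a x : norm_l2 (a *: x) = `|a| * norm_l2 x.
Proof.
apply/eqP; rewrite -(@eqrXn2 _ 2) ?mulr_ge0 ?norm_l2_ge0//.
rewrite exprMn -!norm_l2_sqr inner_l2Zl inner_l2C inner_l2Zl rmorphM /= -inner_l2C.
by rewrite mulrA -sqr_normc.
Qed.

Lemma norm_l2_eq0 x : norm_l2 x = 0 -> x = 0.
Proof. by move=> x0; apply: inner_l2_eq0; rewrite norm_l2_sqr x0 expr0n. Qed.

End SquareSummable.

HB.instance Definition _ (R : realType) :=
  Lmodule_isNormed.Build R[i] (l2 R) norm_l2D norm_l2Z norm_l2_eq0.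

Section L2Hilbert.
Context {R : realType}.
Implicit Types (x y z : l2 R).

Lemma cvg_sqn_comp (T : Type) (F : set_system T) {FF : Filter F}
    (f : T -> R[i]) (z : R[i]) :
  f t @[t --> F] --> z -> sqn (f t) @[t --> F] --> sqn z.
Proof.
move=> fz; rewrite /sqn; apply: cvgD; rewrite expr2; under eq_fun do rewrite expr2;
  apply: cvgM; by [exact: cvg_Re | exact: cvg_Im].
Qed.

Lemma norm_l2_le x (e : R) : 0 <= e ->
  (forall n, \sum_(0 <= k < n) sqn (x k) <= e ^+ 2) -> `|x| <= e%:C.
Proof.
move=> e0 xe; rewrite lecR -(@ler_pXn2r _ 2)// ?nnegrE ?sqrtr_ge0//.
rewrite sqr_sqrtr; last by have := inner_l2_ge0 x; rewrite lecE => /andP[].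
exact: inner_l2_le.
Qed.

Lemma sum_sqn_norm x n : \sum_(0 <= k < n) sqn (x k) <= complex.Re `|x| ^+ 2.
Proof.
rewrite /= sqr_sqrtr; last by have := inner_l2_ge0 x; rewrite lecE => /andP[].
exact: series_sqn_le.
Qed.

Lemma norm_coord_le x k : `|x k| <= `|x|.
Proof.
rewrite -(@ler_pXn2r _ 2)// ?nnegrE//.
rewrite sqnE -[`|x|]/(norm_l2 x) -norm_l2_sqr inner_l2_sqn lecR.
have := series_sqn_le x k.+1; rewrite inner_l2_sqn big_nat_recr//=.
by apply: le_trans; rewrite lerDr sumr_ge0// => j _; exact: sqn_ge0.
Qed.

(** A Cauchy filter converges coordinatewise to some f.  If x lies within e of
    almost every y, each partial sum of squared moduli of x - y is at most e^2,
    and this bound passes to x - f; hence f = x - (x - f) is square-summable and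
    within e of x. *)
Lemma l2_complete (F : set_system (l2 R)) :
  ProperFilter F -> cauchy F -> cvg F.
Proof.
move=> FF /cauchyP Fc.
have /choice[f Ff] k : exists z : R[i], (fun x : l2 R => x k) @ F --> z.
  apply/cvg_ex; apply: complex_complete; apply/cauchyP => e e0.
  have [x Fx] := Fc _ e0.
  exists (x k); suff : F ((fun y : l2 R => y k) @^-1` ball (x k) e) by [].
  apply: filterS Fx => y; rewrite /ball /=; apply: le_lt_trans.
  exact: (norm_coord_le (x - y) k).
have fE (e : R) x : 0 < e -> F (ball x e%:C) ->
    forall n, \sum_(0 <= k < n) sqn (x k - f k) <= e ^+ 2.
  move=> e0 Fx n.
  have cvgs : (fun y : l2 R => \sum_(0 <= k < n) sqn (x k - y k)) @ F -->
      \sum_(0 <= k < n) sqn (x k - f k).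
    apply: cvg_big => [|k _]; first exact: add_continuous.
     apply: cvg_sqn_comp; apply: cvgB; last exact: Ff.
    exact: cvg_cst.
  apply: (cvgr_to_le cvgs); apply: filterS Fx => y.
  move=> xye; have : `|x - y| <= e%:C := ltW xye; rewrite lecE => /andP[_ xy].
  apply: le_trans (sum_sqn_norm (x - y) n) _.
  by rewrite ler_pXn2r// nnegrE ?sqrtr_ge0// ltW.
have [x1 Fx1] := Fc _ ltr01.
have gP : (fun k => x1 k - f k) \in sqsum.
  by apply/asboolP; exists (1 ^+ 2) => n; apply: fE => //; exact: ltr01.
pose g : l2 R := x1 - L2 gP.
have gE k : g k = f k by rewrite /g l2D l2N /= opprB addrC subrK.
apply/cvg_ex; exists g; apply/cvg_ballP => _ /gt0_complexE[e e0 ->].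
have e2 : 0 < e / 2 by rewrite divr_gt0.
have [|x Fx] := Fc (e / 2)%:C; first by rewrite ltcR.
near=> y.
change (`|g - y| < e%:C); rewrite -(subrK x g) -addrA.
apply: le_lt_trans (ler_normD _ _) _; rewrite [e]splitr rmorphD ler_ltD//.
  rewrite distrC; apply: norm_l2_le; first exact: ltW.
  by move=> n; under eq_bigr do rewrite l2D l2N gE; exact: fE.
by near: y; exact: Fx.
Unshelve. all: by end_near. Qed.

End L2Hilbert.

HB.instance Definition _ (R : realType) :=
  Uniform_isComplete.Build (l2 R) (@l2_complete R).

HB.instance Definition _ (R : realType) :=
  CompleteNormedModule_isHilbert.Build R (l2 R)
    inner_l2Dl inner_l2Zl inner_l2C norm_l2_sqr.

Section L2Separable.
Context {R : realType}.

Lemma finite_support_sum_le (f : nat -> R[i]) n :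
  (forall k, (n <= k)%N -> f k = 0) ->
  forall m, \sum_(0 <= k < m) sqn (f k) <= \sum_(0 <= k < n) sqn (f k).
Proof.
move=> f0 m; have [mn|nm] := leqP m n.
  rewrite (big_cat_nat (leq0n _) mn)//= lerDl sumr_ge0// => k _; exact: sqn_ge0.
rewrite (big_cat_nat (leq0n _) (ltnW nm))//= gerDl.
rewrite big_nat_cond big1// => k /andP[/andP[nk _] _].
by rewrite f0// /sqn /= expr0n addr0.
Qed.

Lemma finite_support_sqsum (f : nat -> R[i]) n :
  (forall k, (n <= k)%N -> f k = 0) -> f \in sqsum.
Proof.
by move=> f0; apply/asboolP; exists (\sum_(0 <= k < n) sqn (f k)); exact: finite_support_sum_le.
Qed.

Definition rat_seq (s : seq (rat * rat)) (k : nat) : R[i] :=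
  ratr (nth (0, 0) s k).1 +i* ratr (nth (0, 0) s k).2.

Lemma rat_seq_sqsum s : rat_seq s \in sqsum.
Proof.
apply: (@finite_support_sqsum _ (size s)) => k sk.
by rewrite /rat_seq nth_default//= raddf0.
Qed.

(** Finitely supported sequences with rational coordinates are dense. *)
Lemma l2_separable : separable_space (l2 R).
Proof.
exists (range (fun s => L2 (rat_seq_sqsum s))); split.
  exact: (card_le_trans (card_image_le _ _) (countableP _)).
move=> O [x Ox] Oop.
have /nbhs_ballP[_ /gt0_complexE[e e0 ->] xeO] : nbhs x O by apply: open_nbhs_nbhs.
suff [s xs] : exists s, `|x - L2 (rat_seq_sqsum s)| <= (e / 2)%:C.
  exists (L2 (rat_seq_sqsum s)); split; last by exists s.
  apply: xeO; apply: le_lt_trans xs _.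
  by rewrite ltcR ltr_pdivrMr// ltr_pMr// ltr1n.
(* half of the error is spent on the tail, half on the first n coordinates *)
set d := (e / 2) ^+ 2 / 2.
have d0 : 0 < d by rewrite divr_gt0// exprn_gt0// divr_gt0.
have [n xn] : exists n, complex.Re (inner_l2 x x) - d <= \sum_(0 <= k < n) sqn (x k).
  have /cvgrPdist_le/(_ _ d0)[n _ /(_ n (leqnn n))] := @cvg_sqn _ x.
  by rewrite ler_distl => /andP[_ xn]; exists n; rewrite inner_l2_sqn /= lerBlDr.
have dn0 : 0 < d / n.+1%:R by rewrite divr_gt0.
have approx (a : R) : exists q : rat, (a - ratr q) ^+ 2 <= d / n.+1%:R / 2.
  set t := d / n.+1%:R / 2.
  have t0 : 0 < t by rewrite divr_gt0.
  have at0 : a - Num.sqrt t < a + Num.sqrt t.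
    by rewrite ltrBlDr -addrA ltrDl addr_gt0// sqrtr_gt0.
  have [q] := rat_in_itvoo at0; rewrite in_itv/= => /andP[q1 q2]; exists q.
  rewrite -(sqr_sqrtr (ltW t0)) -real_normK ?num_real// ler_pXn2r// ?nnegrE ?sqrtr_ge0//.
  by rewrite ler_distl; apply/andP; split; lra.
have /choice[f xf] k : exists q : rat * rat,
    sqn (x k - ratr q.1 +i* ratr q.2) <= d / n.+1%:R.
  have [q qP] := approx (complex.Re (x k)); have [r rP] := approx (complex.Im (x k)).
  exists (q, r); rewrite /sqn; move: qP rP; case: (x k) => a b /=.
  by move=> *; rewrite [leRHS]splitr lerD.
exists (mkseq f n); apply: norm_l2_le; first by rewrite divr_ge0// ltW.
move=> m; rewrite (_ : _ ^+ 2 = d + d); last by rewrite /d -splitr.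
have y_eq k : (k < n)%N -> rat_seq (mkseq f n) k = ratr (f k).1 +i* ratr (f k).2.
  by move=> kn; rewrite /rat_seq nth_mkseq.
have y_eq0 k : (n <= k)%N -> rat_seq (mkseq f n) k = 0.
  by move=> nk; rewrite /rat_seq nth_default ?size_mkseq//= raddf0.
apply: (@le_trans _ _ (\sum_(0 <= k < maxn n m)
    sqn (x k - rat_seq (mkseq f n) k))).
  rewrite (big_cat_nat (leq0n _) (leq_maxr n m))//= lerDl sumr_ge0// => k _; exact: sqn_ge0.
rewrite (big_cat_nat (leq0n _) (leq_maxl n m))//= lerD//.
  apply: (@le_trans _ _ (\sum_(0 <= k < n) d / n.+1%:R)).
    by rewrite !big_mkord; apply: ler_sum => k _; rewrite y_eq.
  rewrite big_const_nat subn0 iter_addr_0 -mulrnAr -[leRHS]mulr1 ler_wpM2l ?(ltW d0)//.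
  by rewrite -[leLHS]mulr_natl ler_pdivrMr// mul1r ler_nat.
rewrite (@eq_big_nat _ _ _ _ _ _ (fun k => sqn (x k))); last first.
  by move=> k /andP[nk _]; rewrite y_eq0// subr0.
have := series_sqn_le x (maxn n m).
by rewrite (big_cat_nat (leq0n _) (leq_maxl n m))//= => ?; lra.
Qed.

End L2Separable.

(** * Orthogonal projections and operator norms *)

Section HilbertGeometry.
Context {R : realType} {H : hilbertType R}.
Implicit Types (x y z u : H) (a : R[i]) (P Q T : H -> H) (M : set H).

Lemma innerDr x y z : inner x (y + z) = inner x y + inner x z.
Proof. by rewrite innerC innerDl rmorphD /= -!innerC. Qed.

Lemma innerZr a x y : inner x (a *: y) = a^*%C * inner x y.
Proof. by rewrite innerC innerZl rmorphM /= -innerC. Qed.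

Lemma innerZr_real (r : R) x y : inner x (r%:C *: y) = r%:C * inner x y.
Proof. by rewrite innerZr; congr (_ * _); rewrite /= oppr0. Qed.

Lemma inner0l x : inner 0 x = 0.
Proof. by rewrite -(scale0r 0) innerZl mul0r. Qed.

Lemma inner0r x : inner x 0 = 0.
Proof. by rewrite innerC inner0l conjc0. Qed.

Lemma innerNl x y : inner (- x) y = - inner x y.
Proof. by rewrite -scaleN1r innerZl mulN1r. Qed.

Lemma innerBl x y z : inner (x - y) z = inner x z - inner y z.
Proof. by rewrite innerDl innerNl. Qed.

Lemma innerNr x y : inner x (- y) = - inner x y.
Proof. by rewrite innerC innerNl rmorphN /= -innerC. Qed.

Lemma innerBr x y z : inner x (y - z) = inner x y - inner x z.
Proof. by rewrite innerDr innerNr. Qed.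

Lemma inner_sym0 x y : inner x y = 0 -> inner y x = 0.
Proof. by move=> xy; rewrite innerC xy conjc0. Qed.

(** The squared norm, as a real number. *)
Definition nsq x : R := complex.Re `|x| ^+ 2.

Lemma norm_Re x : `|x| = (complex.Re `|x|)%:C.
Proof. by rewrite RRe_real// normr_real. Qed.

Lemma Re_norm_ge0 x : 0 <= complex.Re `|x|.
Proof. by rewrite -ler0c -norm_Re. Qed.

Lemma nsqE x : inner x x = (nsq x)%:C.
Proof. by rewrite inner_norm norm_Re rmorphXn. Qed.

Lemma nsq_ge0 x : 0 <= nsq x.
Proof. exact: sqr_ge0. Qed.

Lemma nsq_eq0 x : nsq x = 0 -> x = 0.
Proof.
move=> /eqP; rewrite sqrf_eq0 => /eqP x0; apply/normr0_eq0.
by rewrite norm_Re x0.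
Qed.

Lemma nsqZ a x : nsq (a *: x) = sqn a * nsq x.
Proof.
apply: complexI; rewrite -nsqE innerZl innerZr mulrA -sqr_normc sqnE nsqE.
by rewrite -rmorphM.
Qed.

Lemma nsqN x : nsq (- x) = nsq x.
Proof. by rewrite /nsq normrN. Qed.

Lemma pythagoras x y : inner x y = 0 -> nsq (x + y) = nsq x + nsq y.
Proof.
move=> xy; apply: complexI; rewrite -nsqE rmorphD /= -!nsqE.
by rewrite innerDl !innerDr xy (inner_sym0 xy) addr0 add0r.
Qed.

Lemma pythagorasB x y : inner x y = 0 -> nsq (x - y) = nsq x + nsq y.
Proof. by move=> xy; rewrite pythagoras ?nsqN// innerNr xy oppr0. Qed.

Lemma norm_le_nsq (M : R) x y : 0 <= M ->
  (`|x| <= M%:C * `|y|) = (nsq x <= M ^+ 2 * nsq y).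
Proof.
move=> M0; rewrite norm_Re (norm_Re y) -rmorphM lecR -exprMn ler_pXn2r// nnegrE.
  exact: Re_norm_ge0.
by rewrite mulr_ge0// Re_norm_ge0.
Qed.

(* operator norm *)

Lemma opnorm_le T (M : R) : 0 <= M -> (forall x, `|T x| <= M%:C * `|x|) ->
  opnorm T <= M.
Proof.
move=> M0 TM; apply: ge_sup; first by exists (complex.Re `|T 0|), 0 => //=; rewrite normr0.
move=> _ [x /= x1 <-]; rewrite -lecR -norm_Re; apply: le_trans (TM x) _.
by rewrite -[leRHS]mulr1 ler_wpM2l// ler0c.
Qed.

Lemma opnorm_ge T x : bounded_op T -> `|x| <= 1 -> complex.Re `|T x| <= opnorm T.
Proof.
move=> [M TM] x1; apply: ub_le_sup; last by exists x.
exists `|M| => _ [y /= y1 <-]; rewrite -lecR -norm_Re; apply: le_trans (TM y) _.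
apply: (@le_trans _ _ (`|M|%:C * `|y|)); first by rewrite ler_wpM2r// lecR ler_norm.
by rewrite -[leRHS]mulr1 ler_wpM2l// ler0c.
Qed.

Lemma opnorm_nsq T x : bounded_op T -> (forall a x, T (a *: x) = a *: T x) ->
  nsq (T x) <= opnorm T ^+ 2 * nsq x.
Proof.
move=> bT TZ; have [->|x0] := eqVneq x 0.
  by rewrite -(scale0r 0) TZ !scale0r /nsq normr0 /= expr0n mulr0.
have r0 : 0 < complex.Re `|x| by rewrite -ltcR -norm_Re normr_gt0.
set t := (complex.Re `|x|)^-1.
have := @opnorm_ge T (t%:C *: x) bT.
rewrite TZ !normrZ (norm_Re x) (norm_Re (T x)) (@ger0_norm _ t%:C) ?ler0c ?invr_ge0 ?(ltW r0)//.
rewrite -!rmorphM lecR /t mulVf ?gt_eqF// => /(_ (lexx _)) /=.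
rewrite ler_pdivrMl// mulrC => Tx.
by rewrite /nsq -exprMn ler_pXn2r// nnegrE ?Re_norm_ge0// (le_trans (Re_norm_ge0 _) Tx).
Qed.

(* orthogonal projections *)

(** If y has the defining property of P x, then P x - y lies in M and is
    orthogonal to M. *)
Lemma orthoproj_uniq M P x y : closed_subspace M -> orthoproj_onto M P ->
  M y -> (forall z, M z -> inner (x - y) z = 0) -> P x = y.
Proof.
move=> [_ _ Mlin] MP My yP; have [MPx xP] := MP x.
have MPxy : M (P x - y) by rewrite -scaleN1r addrC; exact: Mlin.
apply/eqP; rewrite -subr_eq0; apply/eqP/nsq_eq0/complexI; rewrite -nsqE.
have /(congr1 (inner^~ (P x - y))) : P x - y = (x - y) - (x - P x).
  by rewrite opprB [RHS]addrC subrKA.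
by move=> /= ->; rewrite innerBl (yP _ MPxy) (xP _ MPxy) subr0.
Qed.

Lemma orthoproj_onto_id M P x : closed_subspace M -> orthoproj_onto M P ->
  M x -> P x = x.
Proof.
by move=> cM MP Mx; apply: (orthoproj_uniq cM MP Mx) => z _; rewrite subrr inner0l.
Qed.

Section OrthoProj.
Variable P : H -> H.
Hypothesis oP : orthoproj P.

Lemma orthoproj_idem x : P (P x) = P x.
Proof. by have [M [cM MP]] := oP; apply: (orthoproj_onto_id cM MP); have [] := MP x. Qed.

Lemma orthoprojD x y : P (x + y) = P x + P y.
Proof.
have [M [cM MP]] := oP; have [Mx xP] := MP x; have [My yP] := MP y.
have [_ _ Ml] := cM.
apply: (orthoproj_uniq cM MP); first by rewrite -[P x]scale1r; exact: Ml.
by move=> z Mz; rewrite opprD addrACA innerDl xP// yP// addr0.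
Qed.

Lemma orthoprojZ a x : P (a *: x) = a *: P x.
Proof.
have [M [cM MP]] := oP; have [Mx xP] := MP x; have [_ M0 Ml] := cM.
apply: (orthoproj_uniq cM MP); first by rewrite -[_ *: _]addr0; exact: Ml.
by move=> z Mz; rewrite -scalerBr innerZl xP// mulr0.
Qed.

Lemma orthoprojN x : P (- x) = - P x.
Proof. by rewrite -scaleN1r orthoprojZ scaleN1r. Qed.

Lemma orthoproj_orth x y : inner (x - P x) (P y) = 0.
Proof. by have [M [cM MP]] := oP; have [_] := MP x; apply; have [] := MP y. Qed.

Lemma orthoproj_sym x y : inner (P x) y = inner x (P y).
Proof.
have /eqP := orthoproj_orth x y; rewrite innerBl subr_eq0 => /eqP ->.
have := inner_sym0 (orthoproj_orth y x); rewrite innerBr => /eqP.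
by rewrite subr_eq0 => /eqP.
Qed.

Lemma orthoproj_nsq x : inner (P x) x = (nsq (P x))%:C.
Proof. by rewrite -nsqE -[in RHS]orthoproj_sym orthoproj_idem. Qed.

Lemma orthoproj_decomp x : nsq x = nsq (P x) + nsq (x - P x).
Proof.
by rewrite -(pythagoras (inner_sym0 (orthoproj_orth x x))) addrC subrK.
Qed.

Lemma orthoproj_le x : nsq (P x) <= nsq x.
Proof. by rewrite (orthoproj_decomp x) lerDl nsq_ge0. Qed.

Lemma orthoprojC_le x : nsq (x - P x) <= nsq x.
Proof. by rewrite (orthoproj_decomp x) lerDr nsq_ge0. Qed.

End OrthoProj.

(** In P - Q = P (1 - Q) - (1 - P) Q the two terms have orthogonal ranges, so
    the squared norm of the difference at x is at most that of (1 - Q) x plus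
    that of Q x. *)
Lemma orthoprojB_nsq P Q x : orthoproj P -> orthoproj Q -> nsq (P x - Q x) <= nsq x.
Proof.
move=> oP oQ.
have -> : P x - Q x = P (x - Q x) - (Q x - P (Q x)).
  rewrite (orthoprojD oP) (orthoprojN oP).
  by rewrite opprB addrA subrK.
rewrite pythagorasB; last exact: (inner_sym0 (orthoproj_orth oP _ _)).
by rewrite (orthoproj_decomp oQ x) addrC lerD ?orthoproj_le ?orthoprojC_le.
Qed.

(** A difference of projections is a contraction, so one vector whose length it
    preserves settles its norm. *)
Lemma opnorm_orthoprojB P Q x : orthoproj P -> orthoproj Q ->
  x != 0 -> nsq (P x - Q x) = nsq x -> opnorm (P \- Q) = 1.
Proof.
move=> oP oQ x0 PQx.
have bPQ y : `|(P \- Q) y| <= 1%:C * `|y|.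
  by rewrite norm_le_nsq// expr1n mul1r orthoprojB_nsq.
apply/eqP; rewrite eq_le (opnorm_le _ bPQ)//=.
have nx : 0 < nsq x by rewrite lt_def nsq_ge0 andbT; apply: contraNneq x0 => /nsq_eq0/eqP.
have lin a y : (P \- Q) (a *: y) = a *: (P \- Q) y.
  by rewrite /= (orthoprojZ oP) (orthoprojZ oQ) scalerBr.
have := @opnorm_nsq _ x (ex_intro _ 1 bPQ) lin.
rewrite [nsq _]PQx -[leLHS]mul1r ler_pM2r// -[1 in leLHS](expr1n _ 2).
have ge0 : 0 <= opnorm (P \- Q).
  apply: le_trans (opnorm_ge (ex_intro _ 1 bPQ) (x := 0) _); first exact: Re_norm_ge0.
  by rewrite normr0.
by rewrite ler_pXn2r// nnegrE.
Qed.

End HilbertGeometry.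

Section SymmetricIdempotent.
Context {R : realType} {H : hilbertType R}.
Implicit Types (x y u : H) (P Q T : H -> H) (M : set H).

(** The range of P is its set of fixed points.  It is closed because 1 - P is a
    contraction vanishing on it: for y in the range, the norm of x - P x is at
    most that of x - y. *)
Lemma orthoproj_sym_idem P :
  (forall x y, P (x + y) = P x + P y) -> (forall a x, P (a *: x) = a *: P x) ->
  (forall x y, inner (P x) y = inner x (P y)) -> (forall x, P (P x) = P x) ->
  orthoproj P.
Proof.
move=> PD PZ Psym Pid; pose M := [set x | P x = x].
have orth x y : P y = y -> inner (x - P x) y = 0.
  by move=> Py; rewrite innerBl Psym Py subrr.
have PN x : P (- x) = - P x by rewrite -scaleN1r PZ scaleN1r.
have le x : nsq (x - P x) <= nsq x.
  have := pythagoras (orth x _ (Pid x)); rewrite subrK => ->.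
  by rewrite lerDl nsq_ge0.
exists M; split; last by move=> x; split; [exact: Pid | move=> y; exact: orth].
split; last by rewrite /M => a x y /= Px Py; rewrite PD PZ Px Py.
  move=> x clx; suff /nsq_eq0/eqP : nsq (x - P x) = 0 by rewrite subr_eq0 => /eqP.
  apply/eqP; rewrite eq_le nsq_ge0 andbT; apply/ler_addgt0Pl => e e0.
  rewrite addr0.
  have s0 : 0 < (Num.sqrt e)%:C :> R[i] by rewrite ltcR sqrtr_gt0.
  have [y [/= Py xy]] := clx _ (nbhsx_ballx x _ s0).
  have -> : x - P x = (x - y) - P (x - y).
    by rewrite PD PN Py opprB addrA subrK.
  apply: le_trans (le _) _; rewrite -(sqr_sqrtr (ltW e0)).
  rewrite ler_pXn2r ?nnegrE ?sqrtr_ge0 ?Re_norm_ge0//.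
  by move: xy; rewrite -ball_normE /= => /ltW; rewrite norm_Re lecR.
by rewrite /M /= -(scale0r 0) PZ !scale0r.
Qed.

Lemma orthoprojC P : orthoproj P -> orthoproj (fun x => x - P x).
Proof.
move=> oP; apply: orthoproj_sym_idem => [x y|a x|x y|x].
- by rewrite (orthoprojD oP) opprD addrACA.
- by rewrite (orthoprojZ oP) scalerBr.
- by rewrite innerBl innerBr (orthoproj_sym oP).
- by rewrite (orthoprojD oP) (orthoprojN oP) (orthoproj_idem oP) subrr subr0.
Qed.

Lemma orthoproj_id : orthoproj (@id H).
Proof. exact: orthoproj_sym_idem. Qed.

Lemma orthoproj_zero : orthoproj (fun _ : H => 0).
Proof.
by apply: orthoproj_sym_idem => *; rewrite ?addr0 ?scaler0 ?inner0l ?inner0r.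
Qed.

Definition line_proj u x : H := inner x u *: u.

Lemma line_proj_id u : nsq u = 1 -> line_proj u u = u.
Proof. by move=> u1; rewrite /line_proj nsqE u1 scale1r. Qed.

Lemma line_proj_eq0 u x : inner x u = 0 -> line_proj u x = 0.
Proof. by rewrite /line_proj => ->; rewrite scale0r. Qed.

Lemma orthoproj_line u : nsq u = 1 -> orthoproj (line_proj u).
Proof.
move=> u1; apply: orthoproj_sym_idem => [x y|a x|x y|x]; rewrite /line_proj.
- by rewrite innerDl scalerDl.
- by rewrite innerZl scalerA.
- by rewrite innerZl innerZr (innerC y u) mulrC.
- by rewrite innerZl nsqE u1 mulr1.
Qed.

(** An invariant subspace of an operator without eigenvectors is either zero or
    of dimension at least two.  In the first case P - Q fixes u; in the second
    the subspace contains a nonzero vector orthogonal to u, which P - Q maps to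
    its opposite.  For x in the subspace such a vector is found among the
    combinations of x and T x. *)
Lemma opnorm_line_proj_invariant u T M Q : nsq u = 1 ->
  (forall (z : R[i]) x, T x = z *: x -> x = 0) ->
  closed_subspace M -> invariant_subspace T M -> orthoproj_onto M Q ->
  opnorm (line_proj u \- Q) = 1.
Proof.
move=> u1 noeig cM TM MQ.
have oP := orthoproj_line u1.
have oQ : orthoproj Q by exists M.
have u0 : u != 0.
  by apply: contra_eq_neq u1 => ->; rewrite /nsq normr0 /= expr0n eq_sym oner_neq0.
have [M0|] := pselect (forall x, M x -> x = 0).
  apply: (opnorm_orthoprojB oP oQ u0).
  have /M0 -> : M (Q u) by have [] := MQ u.
  by rewrite subr0 line_proj_id.
move=> /existsNP[x /not_implyP[Mx /eqP x0]].
suff [y [My yu y0]] : exists y, [/\ M y, inner y u = 0 & y != 0].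
  apply: (opnorm_orthoprojB oP oQ y0).
  by rewrite (line_proj_eq0 yu) (orthoproj_onto_id cM MQ My) sub0r nsqN.
have [xu|xu] := eqVneq (inner x u) 0; first by exists x.
have [_ M0 Ml] := cM.
exists (inner (T x) u *: x - inner x u *: T x); split.
- rewrite -scaleNr; apply: (Ml) => //.
  by rewrite -[_ *: T x]addr0; apply: Ml => //; exact: TM.
- by rewrite innerBl !innerZl mulrC subrr.
- rewrite subr_eq0; apply: contra_neq x0 => Tx.
  apply: (noeig ((inner x u)^-1 * inner (T x) u)).
  by rewrite -scalerA Tx scalerA mulVf// scale1r.
Qed.

End SymmetricIdempotent.

(** * Spectral measures: invariant ranges and eigenvectors *)

(** A finite measure concentrated on one side of its own mean vanishes; the
    sign s tells the side. *)
Lemma measure_mean_one_side (R : realType)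
    (mu : {measure set (measurableTypeR R) -> \bar R})
    (D : set (measurableTypeR R)) (a s m : R) :
  measurable D -> mu.-integrable setT (EFin : measurableTypeR R -> \bar R) ->
  mu setT = m%:E -> mu (~` D) = 0%E -> (\int[mu]_t (t : R))%R = a * m ->
  (forall t : R, D t -> 0 < s * (t - a)) -> mu D = 0%E.
Proof.
move=> mD muI muT muC mean Da.
have cI (c : R) : mu.-integrable setT (EFin \o cst c).
  apply/integrableP; split; first exact/measurable_EFinP.
  under eq_integral do rewrite /=.
  by rewrite (integral_cst mu measurableT) muT -EFinM ltry.
pose g (t : measurableTypeR R) : R := s * (t - a).
have bI : mu.-integrable setT (fun t : measurableTypeR R => (t - a)%:E).
  by have := integrableB measurableT muI (cI a); apply: eq_integrable => // t _.
have gI : mu.-integrable setT (EFin \o g).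
  by have := integrableZl measurableT s bI; apply: eq_integrable => // t _.
have g0 : (\int[mu]_t g t)%R = 0.
  rewrite (RintegralZl s measurableT bI) (RintegralB measurableT muI (cI a)).
  by rewrite Rintegral_cst// muT mean subrr mulr0.
have gD0 : (\int[mu]_(t in D) (g t)%:E = 0)%E.
  rewrite -[D]setCK -setTD -negligible_integral//; last exact: measurableC.
  by rewrite -[LHS]fineK ?integrable_fin_num// -[fine _]/(\int[mu]_t g t)%R g0.
have mg : measurable_fun D (EFin \o g).
  exact: measurable_funS (measurable_int mu gI).
have /(ae_eq_integral_abs mu mD mg) [N [mN N0 DN]] : (\int[mu]_(t in D) `|(EFin \o g) t| = 0)%E.
  rewrite -gD0; apply: eq_integral => t; rewrite inE => Dt /=.
  by rewrite ger0_norm// ltW// Da.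
apply: (subset_measure0 mD mN _ N0) => t Dt; apply: DN => /= /(_ Dt) [gt0].
by have := Da t Dt; rewrite -/(g t) gt0 ltxx.
Qed.

Section SpectralMeasure.
Context {R : realType} {H : hilbertType R}.
Variables (B : H -> H) (E : set R -> H -> H).
Hypothesis sE : spectral_measure_of B E.
Implicit Types (x y : H) (D S : set R).

Let oE D : measurable D -> orthoproj (E D).
Proof. exact: (spectral_proj sE). Qed.

(** The squared norm of E(set0) x is the measure of the empty set. *)
Lemma spectral_set0 x : E set0 x = 0.
Proof.
have [mu [muE _ _]] := spectral_integral sE x.
apply: nsq_eq0; have := muE _ measurable0.
by rewrite measure0 (orthoproj_nsq (oE measurable0)) => -[].
Qed.

Lemma spectral_setU D S x : measurable D -> measurable S -> D `&` S = set0 ->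
  E (D `|` S) x = E D x + E S x.
Proof.
move=> mD mS DS.
have mF n : measurable (bigcup2 D S n) by rewrite /bigcup2; do 2 case: ifP => //.
have tF : trivIset setT (bigcup2 D S) by rewrite -trivIset_bigcup2.
have := spectral_sigma_additive sE mF tF (x := x); rewrite bigcup2E => cvgE.
suff : \sum_(0 <= k < n) E (bigcup2 D S k) x @[n --> \oo] --> E D x + E S x.
  by move=> ?; apply: cvg_unique cvgE _ => //; exact: norm_hausdorff.
apply: cvg_near_cst; exists 2%N => // n /= n2.
rewrite (big_cat_nat (leq0n _) n2)//= big_nat_recr// big_nat1 /=.
rewrite [X in _ + X]big_nat_cond [X in _ + X]big1 ?addr0// => k /andP[/andP[k2 _] _].
by case: k k2 => [|[|k]] //= _; exact: spectral_set0.
Qed.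

(** As E of the union is a contraction that maps x to x + E(S) x, and E(S) x
    contributes a nonnegative amount to the norm, E(S) x is zero. *)
Lemma spectral_disjoint D S x : measurable D -> measurable S -> D `&` S = set0 ->
  E D x = x -> E S x = 0.
Proof.
move=> mD mS DS Dx; have mU := measurableU _ _ mD mS.
have := orthoproj_le (oE mU) x.
rewrite -lecR -(orthoproj_nsq (oE mU)) spectral_setU// Dx innerDl nsqE.
rewrite (orthoproj_nsq (oE mS)) -rmorphD lecR gerDl => S0.
by apply/nsq_eq0/eqP; rewrite eq_le S0 nsq_ge0.
Qed.

Lemma spectral_setC D x : measurable D -> x = E D x + E (~` D) x.
Proof.
move=> mD; rewrite -spectral_setU ?setICr//; last exact: measurableC.
by rewrite setUCr (spectral_setT sE).
Qed.

(** On the range of E(D) the projection E(S) agrees with that of the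
    intersection of S and D, which annihilates the range of E(~D). *)
Lemma spectral_cross D S x y : measurable D -> measurable S ->
  E D x = x -> E (~` D) y = y -> inner (E S x) y = 0.
Proof.
move=> mD mS Dx Dy.
have mC : measurable (~` D) by exact: measurableC.
have [mSD mSC] : measurable (S `&` D) /\ measurable (S `&` ~` D).
  by split; exact: measurableI.
have -> : E S x = E (S `&` D) x.
  rewrite -{1}(setIT S) -(setUv D) setIUr spectral_setU//.
    rewrite (@spectral_disjoint D (S `&` ~` D))// ?addr0//.
    by rewrite setIA (setIC D) -setIA setICr setI0.
  by rewrite setIACA setICr setI0.
rewrite (orthoproj_sym (oE mSD)) (@spectral_disjoint (~` D) (S `&` D))// ?inner0r//.
by rewrite setIA (setIC _ S) -setIA setICl setI0.
Qed.

(** For x and y in complementary spectral subspaces, the measure of x + y is the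
    sum of the measures of x and of y. *)
Lemma spectral_form_add D x y : measurable D -> E D x = x -> E (~` D) y = y ->
  inner (B (x + y)) (x + y) = inner (B x) x + inner (B y) y.
Proof.
move=> mD Dx Dy.
have [mu [muE muI ->]] := spectral_integral sE (x + y).
have [mux [muxE muxI ->]] := spectral_integral sE x.
have [muy [muyE muyI ->]] := spectral_integral sE y.
rewrite -rmorphD; congr (_%:C); rewrite /Rintegral -fineD ?integrable_fin_num//.
congr fine; rewrite -integral_measure_add//.
apply: eq_measure_integral => S mS _.
rewrite -[RHS]/(measure_add mux muy S) measure_addE muE// muxE// muyE// -EFinD; congr EFin.
rewrite (orthoprojD (oE mS)) innerDl !innerDr (spectral_cross mD mS Dx Dy) addr0.
rewrite (orthoproj_sym (oE mS) y) (inner_sym0 (spectral_cross mD mS Dx Dy)) add0r.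
by rewrite raddfD.
Qed.

Hypothesis BD : forall x y, B (x + y) = B x + B y.
Hypothesis Bsym : selfadjoint B.

(** Additivity of the quadratic form at x + y and at x + i y kills the real and
    the imaginary part of the mixed term. *)
Lemma spectral_cross_form D x y : measurable D -> E D x = x -> E (~` D) y = y ->
  inner (B x) y = 0.
Proof.
move=> mD Dx.
have Re0 z : E (~` D) z = z -> complex.Re (inner (B x) z) = 0.
  move=> Dz; have := spectral_form_add mD Dx Dz.
  rewrite BD innerDl !innerDr (Bsym z x) (innerC (B x) z).
  case: (inner (B x) x) (inner (B z) z) (inner (B x) z) => [a b] [c d] [e f] [] /= h _.
  lra.
move=> Dy; have := Re0 _ Dy.
have := Re0 ('i *: y); rewrite (orthoprojZ (oE (measurableC mD))) Dy innerZr.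
case: (inner (B x) y) => a b /= /(_ erefl) h1 h2; apply/eqP; rewrite eq_complex /= h2 eqxx /=.
by apply/eqP; lra.
Qed.

(** B x is orthogonal to the range of E(~D), which is the orthogonal complement
    of the range of E(D). *)
Lemma spectral_invariant D x : measurable D -> E D x = x -> E D (B x) = B x.
Proof.
move=> mD Dx; have mC : measurable (~` D) by exact: measurableC.
have C0 : E (~` D) (B x) = 0.
  apply/nsq_eq0/complexI; rewrite -(orthoproj_nsq (oE mC)) (orthoproj_sym (oE mC)).
  by rewrite (spectral_cross_form mD Dx)// (orthoproj_idem (oE mC)).
by rewrite [RHS](spectral_setC (B x) mD) C0 addr0.
Qed.

Lemma spectral_commute D x : measurable D -> E D (B x) = B (E D x).
Proof.
move=> mD; have mC : measurable (~` D) by exact: measurableC.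
have EC : E D (E (~` D) (B (E (~` D) x))) = 0.
  apply: (spectral_disjoint mC mD); last exact: (orthoproj_idem (oE mC)).
  by rewrite setICl.
rewrite {1}(spectral_setC x mD) BD (orthoprojD (oE mD)).
rewrite (spectral_invariant mD (orthoproj_idem (oE mD) x)).
rewrite -(spectral_invariant mC (orthoproj_idem (oE mC) x)) EC addr0.
by [].
Qed.

(** The vector y = E(D) x also satisfies B y = a y, so the first moment of its
    measure is a times its mass; but that measure lives on D, strictly on one
    side of a. *)
Lemma spectral_eigen_side (a s : R) D x : measurable D ->
  (forall t, D t -> 0 < s * (t - a)) -> B x = a%:C *: x -> E D x = 0.
Proof.
move=> mD Da Bx; set y := E D x.
have Dy : E D y = y by exact: (orthoproj_idem (oE mD)).
have By : B y = a%:C *: y by rewrite -spectral_commute// Bx (orthoprojZ (oE mD)).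
have [mu [muE muI]] := spectral_integral sE y.
have mC : measurable (~` D) by exact: measurableC.
rewrite By innerZl nsqE -rmorphM => /complexI mean.
have muT : mu setT = (nsq y)%:E by rewrite muE// (spectral_setT sE) nsqE.
have muC : mu (~` D) = 0%E.
  rewrite muE// (spectral_disjoint mD mC _ Dy) ?inner0l//.
  by rewrite setICr.
have muD : mu D = (nsq y)%:E by rewrite muE// Dy nsqE.
by move: (measure_mean_one_side mD muI muT muC (esym mean) Da); rewrite muD => -[/nsq_eq0].
Qed.

Lemma spectral_eigen (a : R) x : B x = a%:C *: x -> E [set a] x = x.
Proof.
move=> Bx.
have up0 : E `]a, +oo[ x = 0.
  apply: (@spectral_eigen_side a 1) Bx => // t; rewrite /= in_itv/= andbT mul1r.
  by rewrite subr_gt0.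
have low0 : E `]-oo, a[ x = 0.
  apply: (@spectral_eigen_side a (-1)) Bx => // t; rewrite /= in_itv/= => ta.
  by rewrite mulN1r opprB subr_gt0.
have ma : measurable [set a] by [].
have split : ~` [set a] = `]-oo, a[ `|` `]a, +oo[.
  apply/seteqP; split=> t /=; rewrite !in_itv/= andbT => ta.
    by move/eqP: ta; rewrite neq_lt => /orP.
  by move=> tE; move: ta; rewrite tE !ltxx => -[].
rewrite [RHS](spectral_setC x ma) split spectral_setU// ?low0 ?up0 ?addr0//.
apply/seteqP; split=> t //=; rewrite !in_itv/= andbT => -[ta].
by move=> /(lt_trans ta); rewrite ltxx.
Qed.

End SpectralMeasure.

(** * Operators with two spectral values *)

Lemma linear_pack (K : nzRingType) (U : lmodType K) (f : U -> U) :
  linear f -> exists g : {linear U -> U}, (g : U -> U) = f.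
Proof.
move=> lf; pose g : {linear U -> U} :=
  HB.pack f (GRing.isLinear.Build _ _ _ _ f lf).
by exists g.
Qed.

Section ProjComb.
Context {R : realType} {H : hilbertType R}.
Variable P : H -> H.
Hypothesis oP : orthoproj P.
Implicit Types (x y : H) (a b : R[i]).

Definition proj_comb a b x : H := a *: P x + b *: (x - P x).

Lemma proj_comb_linear a b : linear (proj_comb a b).
Proof.
move=> r x y; rewrite /proj_comb (orthoprojD oP) (orthoprojZ oP) opprD addrACA.
rewrite -scalerBr !scalerDr !scalerA addrACA ![r * _]mulrC.
by rewrite -!scalerA.
Qed.

Lemma proj_comb_nsq a b x :
  nsq (proj_comb a b x) = sqn a * nsq (P x) + sqn b * nsq (x - P x).
Proof.
rewrite -!nsqZ -pythagoras// innerZl innerZr.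
by rewrite (inner_sym0 (orthoproj_orth oP x x)) !mulr0.
Qed.

Lemma proj_comb_bounded a b : bounded_op (proj_comb a b).
Proof.
exists (complex.Re `|a| + complex.Re `|b|) => x.
have ge0 (z : R[i]) : 0 <= complex.Re `|z| by rewrite normc_def sqrtr_ge0.
rewrite norm_le_nsq ?addr_ge0// proj_comb_nsq (orthoproj_decomp oP x) mulrDr.
have sq (z : R[i]) : sqn z = complex.Re `|z| ^+ 2.
  by rewrite normc_def /= sqr_sqrtr// addr_ge0// sqr_ge0.
rewrite !sq lerD// ler_wpM2r ?nsq_ge0// ler_pXn2r ?nnegrE ?addr_ge0//.
  by rewrite lerDl.
by rewrite lerDr.
Qed.

Lemma proj_combK a b a' b' x : a * a' = 1 -> b * b' = 1 ->
  proj_comb a b (proj_comb a' b' x) = x.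
Proof.
move=> aa bb; have Pc : P (proj_comb a' b' x) = a' *: P x.
  rewrite /proj_comb (orthoprojD oP) !(orthoprojZ oP) (orthoprojD oP) (orthoprojN oP).
  by rewrite !(orthoproj_idem oP) subrr scaler0 addr0.
rewrite {1}/proj_comb Pc /proj_comb [X in X - _]addrC addrK !scalerA aa bb !scale1r.
by rewrite addrC subrK.
Qed.

Lemma proj_comb_sym (a b : R) : selfadjoint (proj_comb a%:C b%:C).
Proof.
move=> x y; rewrite /proj_comb !innerDl !innerDr !innerZl !innerZr_real.
by rewrite (orthoproj_sym oP) (orthoproj_sym (orthoprojC oP)).
Qed.

Lemma proj_comb_resolvent a b z x :
  z *: x - proj_comb a b x = proj_comb (z - a) (z - b) x.
Proof.
have -> : z *: x = z *: P x + z *: (x - P x).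
  by rewrite -scalerDr [P x + _]addrC subrK.
by rewrite /proj_comb opprD addrACA -!scalerBl.
Qed.

(** Away from a and b the resolvent is again a combination of P and 1 - P; at a
    and b the vectors u and v obstruct invertibility. *)
Lemma spectrum_proj_comb a b u v : P u = u -> u != 0 -> P v = 0 -> v != 0 ->
  spectrum (proj_comb a b) = [set a; b].
Proof.
move=> Pu u0 Pv v0; apply/seteqP; split=> z.
  move=> zs; apply: contrapT => /not_orP[za zb]; apply: zs.
  have [/eqP za' /eqP zb'] : z - a != 0 /\ z - b != 0.
    by rewrite !subr_eq0; split; apply/eqP.
  have [S SE] := linear_pack (proj_comb_linear (z - a)^-1 (z - b)^-1).
  exists S; rewrite SE; split; first exact: proj_comb_bounded.
    by move=> x; rewrite proj_comb_resolvent proj_combK// mulVf//; apply/eqP.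
  by move=> x; rewrite proj_comb_resolvent proj_combK// mulfV//; apply/eqP.
have kernel w c : proj_comb a b w = c *: w -> w != 0 ->
    ~ exists S : {linear H -> H}, [/\ bounded_op S,
        forall x, S (c *: x - proj_comb a b x) = x
      & forall x, c *: S x - proj_comb a b (S x) = x].
  by move=> wc w0 [S [_ Sw _]]; move: w0; rewrite -(Sw w) wc subrr linear0 eqxx.
case=> ->; [apply: (kernel u) => //|apply: (kernel v) => //]; rewrite /proj_comb.
  by rewrite Pu subrr scaler0 addr0.
by rewrite Pv subr0 scaler0 add0r.
Qed.

End ProjComb.

Section TwoPointSpectrum.
Context {R : realType} {H : hilbertType R}.
Variables (P : H -> H) (a b : R).
Hypothesis oP : orthoproj P.
Implicit Types (x : H) (D : set R).

Local Notation T := (proj_comb P a%:C b%:C).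

Definition two_point_measure D x : H :=
  (if a \in D then P x else 0) + (if b \in D then x - P x else 0).

(** At most one of the disjoint sets contains c, so the sums are eventually
    constant. *)
Lemma cvg_indicator (F : (set R)^nat) (c : R) (v : H) : trivIset setT F ->
  \sum_(0 <= k < n) (if c \in F k then v else 0) @[n --> \oo] -->
    (if c \in \bigcup_n F n then v else 0).
Proof.
move=> tF; case: ifPn => [|cF].
  rewrite inE => -[i _ ci]; apply: cvg_near_cst; exists i.+1 => // n /= ni.
  rewrite big_mkord (bigD1 (Ordinal ni))//= mem_set// big1 ?addr0// => j ji.
  rewrite memNset// => cj; move/eqP: ji; apply; apply/val_inj => /=.
  by apply: (tF j i) => //; exists c.
apply: cvg_near_cst; apply: nearW => n; apply: big1 => k _.
by rewrite memNset// => ck; move: cF; rewrite mem_set//; exists k.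
Qed.

Lemma integral_two_dirac (p q : {nonneg R}) (g : measurableTypeR R -> \bar R) :
  measurable_fun setT g -> (forall t, 0 <= g t)%E ->
  (\int[measure_add (mscale p (\d_ (a : measurableTypeR R)))
                    (mscale q (\d_ (b : measurableTypeR R)))]_t g t =
    p%:num%:E * g a + q%:num%:E * g b)%E.
Proof.
move=> mg g0; rewrite ge0_integral_measure_add// !ge0_integral_mscale//.
by rewrite !integral_dirac// !diracT !mul1e.
Qed.

(** The measure of x is the combination of the Dirac masses at a and b with
    weights the squared norms of P x and of x - P x. *)
Lemma two_point_spectral_measure :
  spectral_measure_of T two_point_measure.
Proof.
split.
- move=> D mD; rewrite (_ : two_point_measure D =
      fun x => (if a \in D then P x else 0) + (if b \in D then x - P x else 0))//.
  case: (a \in D); case: (b \in D).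
  + rewrite (_ : (fun x => _) = id); first exact: orthoproj_id.
    by apply/funext => x; rewrite addrC subrK.
  + by rewrite (_ : (fun x => _) = P)//; apply/funext => x; rewrite addr0.
  + rewrite (_ : (fun x => _) = (fun x => x - P x)); first exact: orthoprojC.
    by apply/funext => x; rewrite add0r.
  + rewrite (_ : (fun x => _) = (fun _ => 0)); first exact: orthoproj_zero.
    by apply/funext => x; rewrite add0r.
- by move=> x; rewrite /two_point_measure !in_setT addrC subrK.
- move=> F _ tF x; rewrite /two_point_measure.
  under eq_fun do rewrite big_split.
  by apply: cvgD; exact: cvg_indicator.
move=> x.
pose p := NngNum (nsq_ge0 (P x)); pose q := NngNum (nsq_ge0 (x - P x)).
pose mu := measure_add (mscale p (\d_ (a : measurableTypeR R)))
                       (mscale q (\d_ (b : measurableTypeR R))).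
have mid : measurable_fun setT (EFin : measurableTypeR R -> \bar R).
  exact: EFin_measurable.
have PxE : inner (P x) x = (nsq (P x))%:C := orthoproj_nsq oP x.
have CxE : inner (x - P x) x = (nsq (x - P x))%:C := orthoproj_nsq (orthoprojC oP) x.
exists mu; split.
- move=> D mD; transitivity (p%:num%:E * \d_ a D + q%:num%:E * \d_ b D)%E.
    exact: measure_addE.
  rewrite !diracE innerDl /=.
  case: (a \in D); case: (b \in D);
    by rewrite ?inner0l ?PxE ?CxE ?mule1 ?mule0 -?EFinD ?addr0 ?add0r.
- apply/integrableP; split=> //.
  rewrite integral_two_dirac//; first by rewrite -!EFinM -EFinD ltry.
  exact: measurableT_comp.
rewrite /proj_comb innerDl !innerZl PxE CxE -!rmorphM -rmorphD.
congr (_%:C); rewrite /Rintegral integralE !integral_two_dirac//.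
- rewrite !funeposE !funenegE.
  rewrite -!EFinN -!EFin_max -!EFinM -!EFinD /=.
  have maxE (c : R) : Num.max c 0 - Num.max (- c) 0 = c.
    have [c0|/ltW c0] := leP 0 c.
      by rewrite max_r ?oppr_le0// subr0.
    by rewrite max_l ?oppr_ge0// sub0r opprK.
  by rewrite -{1}(maxE a) -{1}(maxE b); ring.
- exact: measurable_funeneg.
- exact: measurable_funepos.
Qed.

(** The chosen spectral measure need not be the explicit one, but every spectral
    measure fixes the range of P and annihilates the kernel of P at the point a,
    since these are the eigenspaces for a and b. *)
Lemma two_point_spectral_projection : a != b ->
  spectral_projection T [set a] = P.
Proof.
move=> ab; have sE : spectral_measure_of T (spectral_projection T).
  exact: (xgetPex _ (ex_intro _ _ two_point_spectral_measure)).
set E := spectral_projection _ in sE *.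
have opD x y : T (x + y) = T x + T y.
  by have := proj_comb_linear oP a%:C b%:C 1 x y; rewrite !scale1r.
have opsym : selfadjoint T by exact: proj_comb_sym.
apply/funext => x; rewrite -{1}(subrK (P x) x) addrC.
rewrite (orthoprojD (spectral_proj sE (measurable_set1 a))).
rewrite (spectral_eigen sE opD opsym); last first.
  by rewrite /proj_comb (orthoproj_idem oP) subrr scaler0 addr0.
rewrite (spectral_disjoint sE (measurable_set1 b) (measurable_set1 a)) ?addr0//.
  by apply/seteqP; split=> // t /= [-> ba]; move: ab; rewrite ba eqxx.
apply: (spectral_eigen sE opD opsym).
rewrite /proj_comb (orthoprojD oP) (orthoprojN oP) (orthoproj_idem oP) subrr.
by rewrite scaler0 add0r subr0.
Qed.

End TwoPointSpectrum.

(** Either a spectral measure exists, and its projections have invariant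
    ranges, or the default value 0 projects onto the zero subspace. *)
Lemma spectral_projection_invariant (R : realType) (H : hilbertType R)
    (B : H -> H) (D : set R) : (forall x y, B (x + y) = B x + B y) -> selfadjoint B ->
  measurable D -> exists M : set H,
    [/\ closed_subspace M, invariant_subspace B M
      & orthoproj_onto M (spectral_projection B D)].
Proof.
move=> BD Bsym mD.
have B0 : B 0 = 0 by apply: (addrI (B 0)); rewrite -BD !addr0.
have [[E sE]|noE] := pselect (exists E : set R -> H -> H, spectral_measure_of B E).
  have sB : spectral_measure_of B (spectral_projection B).
    exact: (xgetPex _ (ex_intro _ _ sE)).
  have [M [cM MP]] := spectral_proj sB mD.
  exists M; split=> // x Mx.
  have := spectral_invariant sB BD Bsym mD (orthoproj_onto_id cM MP Mx).
  by move=> <-; have [] := MP (B x).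
have -> : spectral_projection B = fun _ _ => 0.
  by apply: xgetPN => E sE; apply: noE; exists E.
have [M [cM MP]] := orthoproj_zero (H := H).
exists M; split=> // x Mx.
by rewrite -(orthoproj_onto_id cM MP Mx) B0; have [_ ? _] := cM.
Qed.

(** * The discrete Laplacian on the half-line *)

Section Jacobi.
Context {R : realType}.
Implicit Types (x y : l2 R).

Lemma l2_nsq_le x (M : R) :
  (forall n, \sum_(0 <= k < n) sqn (x k) <= M) -> nsq x <= M.
Proof.
move=> xM; have := inner_l2_le xM; rewrite -[inner_l2 x x]/(inner x x) nsqE.
by [].
Qed.

Lemma sum_le_nsq x n : \sum_(0 <= k < n) sqn (x k) <= nsq x.
Proof. exact: sum_sqn_norm. Qed.

Definition pred_seq (f : nat -> R[i]) (k : nat) : R[i] := if k is j.+1 then f j else 0.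

Lemma sum_succ_le x n : \sum_(0 <= k < n) sqn (x k.+1) <= nsq x.
Proof.
apply: le_trans (sum_le_nsq x n.+1).
by rewrite big_nat_recl//= lerDr sqn_ge0.
Qed.

Lemma sum_pred_le x n : \sum_(0 <= k < n) sqn (pred_seq x k) <= nsq x.
Proof.
case: n => [|n]; first by rewrite big_geq// nsq_ge0.
by rewrite big_nat_recl//= [sqn 0]/sqn /= expr0n !addr0 add0r sum_le_nsq.
Qed.

Lemma succ_sqsum x : (fun k => x k.+1) \in sqsum.
Proof. by apply/asboolP; exists (nsq x) => n; exact: sum_succ_le. Qed.

Lemma pred_sqsum x : pred_seq x \in sqsum.
Proof. by apply/asboolP; exists (nsq x) => n; exact: sum_pred_le. Qed.

Definition backward_shift x : l2 R := L2 (succ_sqsum x).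
Definition forward_shift x : l2 R := L2 (pred_sqsum x).

Lemma shift_adjoint x y : inner (backward_shift x) y = inner x (forward_shift y).
Proof.
apply: inner_l2P.
set v := fun k => x k * (forward_shift y k)^*%C.
rewrite (_ : series _ = (fun n => series v n.+1)).
  by rewrite (cvg_shiftS (series v)); exact: cvg_inner_l2.
have v0 : v 0%N = 0 by exact: (etrans (congr1 _ (conjc0 R)) (mulr0 _)).
by apply/funext => n; rewrite /series /= big_nat_recl//= v0 add0r.
Qed.

Definition jacobi (c : R) x : l2 R := c%:C *: (backward_shift x + forward_shift x).

Lemma jacobiE c x k : jacobi c x k = c%:C * (x k.+1 + pred_seq x k).
Proof. by []. Qed.

Lemma jacobi_linear c : linear (jacobi c).
Proof.
move=> a x y; apply: l2_ext => k.
have predD : pred_seq (a *: x + y) k = a * pred_seq x k + pred_seq y k.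
  by case: k => [|k] //=; rewrite mulr0 addr0.
by rewrite [LHS]jacobiE predD [RHS]l2D l2Z !jacobiE l2D l2Z; ring.
Qed.

Lemma jacobi_sym c : selfadjoint (jacobi c).
Proof.
move=> x y; rewrite /jacobi innerZl innerZr_real !innerDl !innerDr shift_adjoint.
by rewrite (innerC y (forward_shift x)) -(shift_adjoint y x) -innerC addrC.
Qed.

Lemma jacobi_le c x : 0 <= c -> `|jacobi c x| <= (2 * c)%:C * `|x|.
Proof.
move=> c0; rewrite normrZ ger0_norm ?ler0c// mulrC [(2 * c)]mulrC rmorphM -mulrA [leRHS]mulrC.
rewrite ler_wpM2r ?ler0c// rmorph_nat mulr2n mulrDl mul1r.
have shift_le y : nsq y <= nsq x -> `|y| <= `|x|.
  by rewrite -[`|x|]mul1r -[1]/((1 : R)%:C) norm_le_nsq// expr1n mul1r.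
apply: le_trans (ler_normD _ _) _; apply: lerD; apply: shift_le; apply: l2_nsq_le.
  exact: sum_succ_le.
exact: sum_pred_le.
Qed.

(** The eigenvalue equation is the recursion x(k+1) + x(k-1) = mu x(k) with
    x(-1) = 0.  It conserves x(k+1)^2 - mu x(k) x(k+1) + x(k)^2, which starts at
    x(0)^2 and tends to 0 for a square-summable x.  So x(0) = 0, and the
    recursion gives x = 0. *)
Lemma jacobi_no_eigenvector c (z : R[i]) x : 0 < c -> jacobi c x = z *: x -> x = 0.
Proof.
move=> c0 xz; set mu := z / c%:C.
have cC : c%:C != 0 :> R[i] by rewrite eq_complex /= negb_and gt_eqF.
have rec k : x k.+1 = mu * x k - pred_seq x k.
  have : jacobi c x k = z * x k by rewrite xz.
  rewrite jacobiE => e; apply: (mulfI cC); rewrite mulrBr /mu.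
  by rewrite [_ * (_ * x k)]mulrA [_ * (z / _)]mulrC divfK// -e; ring.
have inv k : x k.+1 ^+ 2 - mu * x k * x k.+1 + x k ^+ 2 = x 0%N ^+ 2.
  elim: k => [|k <-]; first by rewrite rec /=; ring.
  by rewrite (rec k.+1) /=; ring.
pose K : R := 1 + complex.Re `|mu|.
have K0 : 0 <= complex.Re `|mu| by rewrite normc_def sqrtr_ge0.
have KE : K%:C = 1 + `|mu| by rewrite /K rmorphD /= (RRe_real (normr_real mu)).
have bound k : sqn (x 0%N) <= K * (sqn (x k.+1) + sqn (x k)).
  have RHS : (K * (sqn (x k.+1) + sqn (x k)))%:C =
      (1 + `|mu|) * (`|x k.+1| ^+ 2 + `|x k| ^+ 2).
    by rewrite !sqnE -KE -rmorphD -rmorphM.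
  rewrite -lecR RHS -sqnE -normrX -(inv k).
  apply: le_trans (ler_normD _ _) _; rewrite normrX.
  apply: (@le_trans _ _ (`|x k.+1| ^+ 2 + `|mu| * `|x k| * `|x k.+1| + `|x k| ^+ 2)).
    by rewrite lerD2r; apply: le_trans (ler_normB _ _) _; rewrite normrX !normrM.
  rewrite [leLHS]addrAC mulrDl mul1r lerD2l -mulrA ler_wpM2l//.
  have [r ->] : exists r : R, `|x k| = r%:C by rewrite normc_def; eexists.
  have [s ->] : exists s : R, `|x k.+1| = s%:C by rewrite normc_def; eexists.
  rewrite -!rmorphXn -rmorphD -rmorphM lecR.
  have := sqr_ge0 (r - s); have := sqr_ge0 (r + s); nra.
have lim0 : K * (sqn (x k.+1) + sqn (x k)) @[k --> \oo] --> K * (0 + 0).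
  apply: cvgMl_tmp; have s0 := cvg_series_cvg_0 (cvg_sqn (x := x)).
  by apply: cvgD => //; rewrite (cvg_shiftS (fun k => sqn (x k))).
have x00 : x 0%N = 0.
  apply/sqn_eq0/eqP; rewrite eq_le sqn_ge0 andbT.
  move: lim0; rewrite addr0 mulr0 => /cvgr_to_ge; apply.
  by apply: nearW => k; exact: bound.
apply: l2_ext => k; rewrite l20.
suff [] : x k = 0 /\ x k.+1 = 0 by [].
elim: k => [|k [xk xk1]]; first by rewrite rec x00 mulr0 subr0.
by split=> //; rewrite rec xk1 /= xk mulr0 subr0.
Qed.

Lemma basis_sqsum j : (fun k => (k == j)%:R : R[i]) \in sqsum.
Proof.
apply: (@finite_support_sqsum _ _ j.+1) => k jk.
by rewrite gtn_eqF.
Qed.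

Definition basis j : l2 R := L2 (basis_sqsum j).

Lemma inner_basis x j : inner x (basis j) = x j.
Proof.
apply: inner_l2P; apply: cvg_near_cst; exists j.+1 => // n /= jn.
rewrite /series /= big_mkord (bigD1 (Ordinal jn))//= eqxx conjc1 mulr1 big1 ?addr0// => k kj.
by rewrite (_ : (nat_of_ord k == j) = false) ?conjc0 ?mulr0//; apply: negbTE.
Qed.

Lemma nsq_basis j : nsq (basis j) = 1.
Proof. by apply: complexI; rewrite -nsqE inner_basis /= eqxx. Qed.

Lemma basis_neq0 j : basis j != 0.
Proof.
by apply: contra_eq_neq (nsq_basis j) => ->; rewrite /nsq normr0 /= expr0n eq_sym oner_neq0.
Qed.

(** The vectors equal to 1 on [1, n + 2] and 0 elsewhere are approximate
    eigenvectors of the Laplacian at the top of its spectrum; they vanish at 0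
    so as to be orthogonal to the first basis vector. *)
Lemma plateau_sqsum n : (fun k => (0 < k <= n.+2)%:R : R[i]) \in sqsum.
Proof.
apply: (@finite_support_sqsum _ _ n.+3) => k nk.
by rewrite [(k <= _)%N]leqNgt nk andbF.
Qed.

Definition plateau n : l2 R := L2 (plateau_sqsum n).

(** The vanishing coordinate 0 is counted too: only the leading order matters. *)
Lemma nsq_plateau n : nsq (plateau n) <= n.+3%:R.
Proof.
apply: l2_nsq_le => m; apply: le_trans (finite_support_sum_le (n := n.+3) _ m) _.
  by move=> k nk; rewrite /= [(k <= _)%N]leqNgt nk andbF.
apply: (@le_trans _ _ (\sum_(0 <= k < n.+3) (1 : R))).
  apply: ler_sum => k _ /=; rewrite /sqn.
  by case: (0 < k <= n.+2)%N; rewrite /= ?expr1n ?expr0n /= ?addr0 ?ler01 ?lexx.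
by rewrite big_const_nat subn0 iter_addr_0.
Qed.

End Jacobi.

(** * The pair of operators *)

Section Perturbation.
Context {R : realType} (d eps : R).
Hypotheses (d_gt0 : 0 < d) (eps_gt0 : 0 < eps).

Let P := line_proj (basis 0 : l2 R).
Let oP : orthoproj P := orthoproj_line (nsq_basis 0).
Definition unperturbed : l2 R -> l2 R := proj_comb P (d / 2)%:C (- (d / 2))%:C.
Definition perturbation (x : l2 R) : l2 R := jacobi (eps / 2) x - unperturbed x.

Let d2_gt0 : 0 < d / 2. Proof. by rewrite divr_gt0. Qed.
Let eps2_gt0 : 0 < eps / 2. Proof. by rewrite divr_gt0. Qed.

Lemma perturbation_linear : linear perturbation.
Proof.
move=> a x y; rewrite /perturbation jacobi_linear /unperturbed (proj_comb_linear oP).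
by rewrite scalerBr opprD addrACA.
Qed.

(** The operator is d/2 times a reflection. *)
Lemma norm_unperturbed x : `|unperturbed x| = (d / 2)%:C * `|x|.
Proof.
rewrite norm_Re (norm_Re x) -rmorphM; congr (_%:C).
have rhs_ge0 : 0 <= d / 2 * complex.Re `|x|.
  by apply: mulr_ge0; [exact: ltW | exact: Re_norm_ge0].
apply/eqP; rewrite -(@eqrXn2 _ 2) ?Re_norm_ge0//; apply/eqP.
rewrite exprMn -/(nsq _) -/(nsq x) proj_comb_nsq// (orthoproj_decomp oP x).
by rewrite /sqn /= expr0n addr0 sqrrN mulrDr addr0.
Qed.

Lemma perturbation_le x : `|perturbation x| <= (d / 2 + eps)%:C * `|x|.
Proof.
apply: le_trans (ler_normB _ _) _; rewrite addrC norm_unperturbed.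
rewrite [(d / 2 + eps)%:C]rmorphD mulrDl lerD2l.
by apply: le_trans (jacobi_le x (ltW eps2_gt0)) _; rewrite [2 * _]mulrC divfK.
Qed.

Lemma perturbation_plateau n k : (1 < k <= n.+1)%N ->
  perturbation (plateau n) k = (d / 2 + eps)%:C.
Proof.
case: k => [|[|k]] // /andP[_ kn].
have Px : P (plateau n) = 0 by apply: line_proj_eq0; rewrite inner_basis.
have -> : perturbation (plateau n) k.+2 =
    (eps / 2)%:C * (plateau n k.+3 + plateau n k.+1) + (d / 2)%:C * plateau n k.+2.
  rewrite /perturbation /unperturbed /proj_comb Px scaler0 add0r subr0.
  by rewrite !(l2D, l2N, l2Z) rmorphN mulNr opprK.
rewrite /= !ltnS in kn *; rewrite kn (ltnW kn) (leqW (ltnW kn)).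
by rewrite -[in RHS](divfK (_ : 2 != 0 :> R) eps)// rmorphD rmorphM /=; ring.
Qed.

(** The upper bound is the triangle inequality.  On the plateau vectors the
    perturbation multiplies n of the n + 2 nonzero coordinates by d/2 + eps, so
    n (d/2 + eps)^2 is at most (n + 3) times the square of the operator norm,
    for every n. *)
Lemma opnorm_perturbation : opnorm perturbation = d / 2 + eps.
Proof.
have S_gt0 : 0 < d / 2 + eps by rewrite addr_gt0.
have bV : bounded_op perturbation by exists (d / 2 + eps); exact: perturbation_le.
have VZ a x : perturbation (a *: x) = a *: perturbation x.
  have [V VE] := linear_pack perturbation_linear.
  by rewrite -VE linearZ.
apply/eqP; rewrite eq_le (opnorm_le (ltW S_gt0) perturbation_le)/=.
set N := opnorm _; set S := d / 2 + eps in S_gt0 *.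
have N_ge0 : 0 <= N.
  by apply: le_trans (opnorm_ge (x := 0) bV _); [exact: Re_norm_ge0 | rewrite normr0].
have bound n : n%:R * S ^+ 2 <= N ^+ 2 * n.+3%:R.
  apply: (@le_trans _ _ (N ^+ 2 * nsq (plateau n))); last first.
    by rewrite ler_wpM2l ?sqr_ge0// nsq_plateau.
  apply: le_trans (opnorm_nsq (plateau n) bV VZ).
  apply: le_trans (sum_le_nsq _ n.+2).
  rewrite 2?big_nat_recl// addrA.
  apply: (@le_trans _ _ (\sum_(0 <= k < n) S ^+ 2)).
    by rewrite big_const_nat subn0 iter_addr_0 mulr_natl.
  apply: ler_wpDl; first by rewrite addr_ge0 ?sqn_ge0.
  rewrite !big_mkord; apply: ler_sum => k _.
  rewrite perturbation_plateau ?ltnS ?ltn_ord//.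
  by rewrite /sqn /= expr0n addr0.
rewrite -(@ler_pXn2r _ 2) ?nnegrE ?(ltW S_gt0)// leNgt; apply/negP => NS.
have gap : 0 < S ^+ 2 - N ^+ 2 by rewrite subr_gt0.
have := bound (Num.bound (3 * N ^+ 2 / (S ^+ 2 - N ^+ 2))).
apply/negP; rewrite -ltNge -addn3 natrD.
have := archi_boundP (_ : 0 <= 3 * N ^+ 2 / (S ^+ 2 - N ^+ 2)).
set m := Num.bound _; rewrite divr_ge0 ?mulr_ge0 ?sqr_ge0 ?(ltW gap)// => /(_ isT).
by rewrite ltr_pdivrMr// => h; lra.
Qed.

End Perturbation.

Theorem mainTheorem3 (R : realType) (d : R) (d_gt0 : 0 < d)
    (eps : R) (eps_gt0 : 0 < eps) :
  exists (H : hilbertType R) (A V : {linear H -> H}) (sigma Sigma : set R),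
    [/\ separable_space H,
        bounded_op A /\ selfadjoint A,
        [/\ sigma !=set0, Sigma !=set0,
            spectrum A = [set t%:C | t in sigma `|` Sigma]
          & setdist sigma Sigma = d],
        [/\ bounded_op V, selfadjoint V & opnorm V = d / 2 + eps]
      & (forall (M : set H) (Q : H -> H),
           closed_subspace M -> invariant_subspace (A \+ V) M ->
           orthoproj_onto M Q ->
           opnorm (spectral_projection A sigma \- Q) = 1)
        /\
        (forall Delta : set R, measurable Delta ->
           opnorm (spectral_projection A sigma
                     \- spectral_projection (A \+ V) Delta) = 1)].
Proof.
have oP := orthoproj_line (nsq_basis 0 : nsq (basis 0 : l2 R) = 1).
have d2 : 0 < d / 2 by rewrite divr_gt0.
have e2 : 0 < eps / 2 by rewrite divr_gt0.
have [A AE] : exists A : {linear l2 R -> l2 R}, (A : l2 R -> l2 R) = unperturbed d.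
  exact/linear_pack/proj_comb_linear.
have [V VE] : exists V : {linear l2 R -> l2 R}, (V : l2 R -> l2 R) = perturbation d eps.
  exact/linear_pack/perturbation_linear.
have AV : A \+ V = jacobi (eps / 2).
  by apply/funext => x /=; rewrite AE VE /perturbation addrC subrK.
have Asym : selfadjoint A by rewrite AE; exact: proj_comb_sym.
have Bsym : selfadjoint (jacobi (eps / 2) : l2 R -> l2 R) := @jacobi_sym R (eps / 2).
have BD x y : jacobi (eps / 2) (x + y) = jacobi (eps / 2) x + jacobi (eps / 2) y.
  by have := @jacobi_linear R (eps / 2) 1 x y; rewrite !scale1r.
have PA : spectral_projection A [set d / 2] = line_proj (basis 0).
  rewrite AE; apply: two_point_spectral_projection => //.
  by rewrite -subr_eq0 opprK -splitr gt_eqF.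
have distance (M : set (l2 R)) Q : closed_subspace M ->
    invariant_subspace (A \+ V) M -> orthoproj_onto M Q ->
    opnorm (spectral_projection A [set d / 2] \- Q) = 1.
  rewrite PA AV => cM MB MQ.
  apply: (opnorm_line_proj_invariant (nsq_basis 0) _ cM MB MQ) => z x.
  exact: jacobi_no_eigenvector.
exists (l2 R : hilbertType R), A, V, [set d / 2], [set - (d / 2)]; split.
- exact: l2_separable.
- by split=> //; rewrite AE; exact: proj_comb_bounded.
- split; first by exists (d / 2).
  + by exists (- (d / 2)).
  + rewrite image_setU !image_set1 AE.
    apply: (@spectrum_proj_comb _ _ _ oP _ _ (basis 0) (basis 1)).
    * exact/line_proj_id/nsq_basis.
    * exact: basis_neq0.
    * by apply: line_proj_eq0; rewrite inner_basis.
    * exact: basis_neq0.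
  + rewrite /setdist (_ : [set _ | _ in _ & _ in _] = [set d]) ?inf1//.
    apply/seteqP; split=> [_ [_ -> [_ -> <-]]|_ ->] /=.
      by rewrite opprK -splitr gtr0_norm.
    exists (d / 2) => //; exists (- (d / 2)) => //.
    by rewrite opprK -splitr gtr0_norm.
- rewrite VE; split; last exact: opnorm_perturbation.
  + by exists (d / 2 + eps); exact: perturbation_le.
  + move=> x y; rewrite /perturbation innerBl innerBr Bsym -AE Asym.
    by [].
- split; first exact: distance.
  move=> D mD.
  have [M [cM MB MQ]] := spectral_projection_invariant BD Bsym mD.
  by apply: (distance M) => //; rewrite AV.
Qed.
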